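(* Let $C$ be a Boolean algebra and let $A, B$ be Boolean subalgebras of $C$. Then the following three conditions are equivalent: (i) $A$ and $B$ are Boolean-subalgebra-independent in $C$; (ii) $A$ and $B$ are Boole-independent; (iii) $A\vee B\cong A\oplus B$, i.e. the canonical homomorphism $q: A\oplus B\to A\vee B$ is an isomorphism.
   Context: For Boolean subalgebras $A,B$ of $C$, $A\vee B$ denotes the Boolean subalgebra of $C$ generated by $A\cup B$. $A$ and $B$ are Boolean-subalgebra-independent in $C$ if for any Boolean homomorphisms $\alpha: A\to A$ and $\beta: B\to B$ there is a Boolean homomorphism $\gamma: A\vee B\to A\vee B$ such that $\gamma(a)=\alpha(a)$ for all $a\in A$ and $\gamma(b)=\beta(b)$ for all $b\in B$. $A$ and $B$ are Boole-independent if for all $a\in A$ and $b\in B$ with $a\neq 0$ and $b\neq 0$ one has $a\wedge b\neq 0$. $A\oplus B$ denotes the coproduct of $A$ and $B$ in the category of Boolean algebras and Boolean homomorphisms, and $q: A\oplus B\to A\vee B$ is the canonical homomorphism induced by the inclusions $A\hookrightarrow A\vee B$ and $B\hookrightarrow A\vee B$. *)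

(* Defs.v *)
From HB Require Import structures.
#[warnings="-notation-overridden"]
From mathcomp Require Import all_boot all_order generic_quotient.
From mathcomp Require Import boolp classical_sets.

Set Implicit Arguments.
Unset Strict Implicit.
Unset Printing Implicit Defensive.

Import Order.Theory.

Local Open Scope order_scope.
Local Open Scope quotient_scope.

(* Boolean algebras are [ctbDistrLatticeType]s; the degenerate one, with
   \bot = \top, is allowed.  The library's {tblmorphism T -> T'} only asks that
   \bot and \top be preserved, so it has to be joined with lattice morphisms. *)

HB.mixin Record isComplMorphism d (T : ctbDistrLatticeType d)
    d' (T' : ctbDistrLatticeType d') (f : T -> T') := {
  bmorphC_subproof : {morph f : x / ~` x}
}.

HB.structure Definition BooleanMorphism d (T : ctbDistrLatticeType d)
    d' (T' : ctbDistrLatticeType d') :=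
  {f of @Order.LatticeMorphism d T d' T' f
      & @Order.TBLatticeMorphism d T d' T' f
      & isComplMorphism d T d' T' f}.

Notation "{ 'bmorphism' T -> T' }" :=
  (@BooleanMorphism.type _ T%type _ T'%type)
  (at level 0, T at level 98, T' at level 99,
   format "{ 'bmorphism'  T  ->  T' }") : type_scope.

HB.factory Record isBooleanMorphism d (T : ctbDistrLatticeType d)
    d' (T' : ctbDistrLatticeType d') (f : T -> T') := {
  bmorphI : {morph f : x y / x `&` y};
  bmorphU : {morph f : x y / x `|` y};
  bmorphC : {morph f : x / ~` x};
  bmorph0 : f \bot = \bot;
  bmorph1 : f \top = \top
}.

HB.builders Context d T d' T' f of isBooleanMorphism d T d' T' f.
Fact bmorph_le : {homo f : x y / x <= y}.
Proof. by move=> x y /meet_idPl xy; apply/meet_idPl; rewrite -bmorphI xy. Qed.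
HB.instance Definition _ := Order.isOrderMorphism.Build d T d' T' f bmorph_le.
HB.instance Definition _ :=
  Order.isLatticeMorphism.Build d T d' T' f bmorphI bmorphU.
HB.instance Definition _ := Order.isBLatticeMorphism.Build d T d' T' f bmorph0.
HB.instance Definition _ := Order.isTLatticeMorphism.Build d T d' T' f bmorph1.
HB.instance Definition _ := isComplMorphism.Build d T d' T' f bmorphC.
HB.end.

Lemma bmorphC d (T : ctbDistrLatticeType d) d' (T' : ctbDistrLatticeType d')
  (f : {bmorphism T -> T'}) : {morph f : x / ~` x}.
Proof. exact: bmorphC_subproof. Qed.

Section IdComp.
Context d (T : ctbDistrLatticeType d) d' (T' : ctbDistrLatticeType d').
Context d'' (T'' : ctbDistrLatticeType d'').
Variables (f : {bmorphism T' -> T''}) (g : {bmorphism T -> T'}).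

Fact idfun_is_compl_morphism : {morph @idfun T : x / ~` x}.
Proof. by []. Qed.
HB.instance Definition _ :=
  isComplMorphism.Build d T d T idfun idfun_is_compl_morphism.

Fact comp_is_compl_morphism : {morph f \o g : x / ~` x}.
Proof. by move=> x; rewrite /= !bmorphC. Qed.
HB.instance Definition _ :=
  isComplMorphism.Build d T d'' T'' (f \o g) comp_is_compl_morphism.

End IdComp.

Definition boolean_iso d (T : ctbDistrLatticeType d)
    d' (T' : ctbDistrLatticeType d') (f : {bmorphism T -> T'}) : Prop :=
  exists g : {bmorphism T' -> T}, cancel f g /\ cancel g f.

Section Subalgebra.
Context d (C : ctbDistrLatticeType d).

Definition boolean_closed (S : set C) : Prop :=
  [/\ S \bot, S \top,
      forall x y, S x -> S y -> S (x `&` y)%O,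
      forall x y, S x -> S y -> S (x `|` y)%O
    & forall x, S x -> S (~` x)%O].

Record subalgebra := Subalgebra {
  subalgebra_set : set C;
  subalgebra_closed : boolean_closed subalgebra_set
}.

Definition subalgebra_sort (A : subalgebra) : Type :=
  {x : C | x \in subalgebra_set A}.

End Subalgebra.

Coercion subalgebra_sort : subalgebra >-> Sortclass.

Section SubalgebraStructure.
Context d (C : ctbDistrLatticeType d) (A : subalgebra C).

Fact subalgebraI : meet_closed (mem (subalgebra_set A)).
Proof.
move=> x y; rewrite !inE; have [_ _ AI _ _] := subalgebra_closed A; exact: AI.
Qed.

Fact subalgebraU : join_closed (mem (subalgebra_set A)).
Proof.
move=> x y; rewrite !inE; have [_ _ _ AU _] := subalgebra_closed A; exact: AU.
Qed.

Fact subalgebra0 : \bot \in mem (subalgebra_set A).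
Proof. by rewrite inE; have [] := subalgebra_closed A. Qed.

Fact subalgebra1 : \top \in mem (subalgebra_set A).
Proof. by rewrite inE; have [] := subalgebra_closed A. Qed.

Fact subalgebraC (x : C) : x \in subalgebra_set A -> ~` x \in subalgebra_set A.
Proof.
rewrite !inE; have [_ _ _ _ Acompl] := subalgebra_closed A; exact: Acompl.
Qed.

HB.instance Definition _ := SubChoice.on (subalgebra_sort A).
HB.instance Definition _ :=
  Order.SubChoice_isTBSubLattice.Build d C (fun x => x \in subalgebra_set A) d
    (subalgebra_sort A) subalgebraI subalgebraU subalgebra0 subalgebra1.

Lemma val_meet (x y : subalgebra_sort A) :
  val (x `&` y) = val x `&` val y :> C.
Proof. by []. Qed.

Lemma val_join (x y : subalgebra_sort A) :
  val (x `|` y) = val x `|` val y :> C.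
Proof. by []. Qed.

Lemma val_bot : val (\bot : subalgebra_sort A) = \bot :> C.
Proof. by []. Qed.

Lemma val_top : val (\top : subalgebra_sort A) = \top :> C.
Proof. by []. Qed.

Fact subalgebra_meetUl :
  left_distributive (@Order.meet _ (subalgebra_sort A)) (@Order.join _ _).
Proof.
by move=> x y z; apply: val_inj; rewrite !(val_meet, val_join) meetUl.
Qed.

HB.instance Definition _ :=
  Order.Lattice_Meet_isDistrLattice.Build d (subalgebra_sort A)
    subalgebra_meetUl.

Definition subalgebra_compl (x : subalgebra_sort A) : subalgebra_sort A :=
  exist _ (~` val x) (subalgebraC (valP x)).

Fact subalgebra_joinxC x : x `|` subalgebra_compl x = \top.
Proof. by apply: val_inj; rewrite val_join joinxC. Qed.

Fact subalgebra_meetxC x : x `&` subalgebra_compl x = \bot.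
Proof. by apply: val_inj; rewrite val_meet meetxC. Qed.

HB.instance Definition _ :=
  Order.TBDistrLattice_hasComplement.Build d (subalgebra_sort A)
    subalgebra_joinxC subalgebra_meetxC.

Lemma val_compl (x : subalgebra_sort A) : val (~` x) = ~` val x :> C.
Proof. by []. Qed.

End SubalgebraStructure.

Section Inclusion.
Context d (C : ctbDistrLatticeType d) (A B : subalgebra C).
Hypothesis AB : (subalgebra_set A `<=` subalgebra_set B)%classic.

Definition inclusion_fun (x : A) : B :=
  exist _ (val x) (mem_set (AB (set_mem (valP x)))).

Fact inclusionI : {morph inclusion_fun : x y / x `&` y}.
Proof. by move=> x y; apply: val_inj. Qed.

Fact inclusionU : {morph inclusion_fun : x y / x `|` y}.
Proof. by move=> x y; apply: val_inj. Qed.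

Fact inclusionC : {morph inclusion_fun : x / ~` x}.
Proof. by move=> x; apply: val_inj. Qed.

Fact inclusion0 : inclusion_fun \bot = \bot.
Proof. by apply: val_inj. Qed.

Fact inclusion1 : inclusion_fun \top = \top.
Proof. by apply: val_inj. Qed.

HB.instance Definition _ := isBooleanMorphism.Build _ _ _ _ inclusion_fun
  inclusionI inclusionU inclusionC inclusion0 inclusion1.

Definition inclusion : {bmorphism A -> B} := inclusion_fun.

End Inclusion.

Section Join.
Context d (C : ctbDistrLatticeType d) (A B : subalgebra C).

Definition subalgebra_join_set : set C :=
  smallest (@boolean_closed d C)
    (subalgebra_set A `|` subalgebra_set B)%classic.

Fact subalgebra_join_closed : boolean_closed subalgebra_join_set.
Proof.
split=> [S [[]]//|S [[]]//|x y Sx Sy S SP|x y Sx Sy S SP|x Sx S SP].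
- by have [[_ _ SI _ _] _] := SP; apply: SI; [apply: Sx|apply: Sy].
- by have [[_ _ _ SU _] _] := SP; apply: SU; [apply: Sx|apply: Sy].
- by have [[_ _ _ _ SC] _] := SP; apply: SC; apply: Sx.
Qed.

Definition subalgebra_join : subalgebra C := Subalgebra subalgebra_join_closed.

Fact sub_joinl : (subalgebra_set A `<=` subalgebra_set subalgebra_join)%classic.
Proof. by move=> x Ax; apply: sub_gen_smallest; left. Qed.

Fact sub_joinr : (subalgebra_set B `<=` subalgebra_set subalgebra_join)%classic.
Proof. by move=> x Bx; apply: sub_gen_smallest; right. Qed.

Definition joinl : {bmorphism A -> subalgebra_join} := inclusion sub_joinl.
Definition joinr : {bmorphism B -> subalgebra_join} := inclusion sub_joinr.

Definition subalgebra_independent : Prop :=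
  forall (alpha : {bmorphism A -> A}) (beta : {bmorphism B -> B}),
  exists gamma : {bmorphism subalgebra_join -> subalgebra_join},
    (forall a : A, gamma (joinl a) = joinl (alpha a)) /\
    (forall b : B, gamma (joinr b) = joinr (beta b)).

Definition boole_independent : Prop :=
  forall a b : C, subalgebra_set A a -> subalgebra_set B b ->
    a <> \bot -> b <> \bot -> a `&` b <> \bot.

End Join.

(* The coproduct is the algebra of Boolean terms over the disjoint union of S
   and T, two terms being identified when they take the same value under every
   pair of Boolean homomorphisms S -> D, T -> D into a common Boolean algebra D.
   Its universal property is [coprod_rec_inl], [coprod_rec_inr] and
   [coprod_rec_unique] below. *)

Inductive bterm (S T : Type) : Type :=
| BInl of S
| BInr of T
| BBot
| BTop
| BMeet of bterm S T & bterm S T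
| BJoin of bterm S T & bterm S T
| BCompl of bterm S T.

Arguments BInl {S T}.
Arguments BInr {S T}.
Arguments BBot {S T}.
Arguments BTop {S T}.

HB.instance Definition _ (S T : Type) := gen_eqMixin (bterm S T).
HB.instance Definition _ (S T : Type) := gen_choiceMixin (bterm S T).

Fixpoint beval (S T : Type) d (D : ctbDistrLatticeType d)
    (f : S -> D) (g : T -> D) (t : bterm S T) : D :=
  match t with
  | BInl x => f x
  | BInr y => g y
  | BBot => \bot
  | BTop => \top
  | BMeet t1 t2 => beval f g t1 `&` beval f g t2
  | BJoin t1 t2 => beval f g t1 `|` beval f g t2
  | BCompl t1 => ~` beval f g t1
  end.

Section Coproduct.
Context d1 (S : ctbDistrLatticeType d1) d2 (T : ctbDistrLatticeType d2).

Definition bterm_equiv : rel (bterm S T) := fun t u =>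
  `[< forall d (D : ctbDistrLatticeType d)
        (f : {bmorphism S -> D}) (g : {bmorphism T -> D}),
      beval f g t = beval f g u >].

Fact bterm_equiv_refl : reflexive bterm_equiv.
Proof. by move=> t; apply/asboolP. Qed.

Fact bterm_equiv_sym : symmetric bterm_equiv.
Proof. by move=> t u; apply/asboolP/asboolP => tu d D f g; rewrite tu. Qed.

Fact bterm_equiv_trans : transitive bterm_equiv.
Proof.
by move=> u t v /asboolP tu /asboolP uv; apply/asboolP => d D f g; rewrite tu.
Qed.

Canonical bterm_equiv_rel :=
  EquivRel bterm_equiv bterm_equiv_refl bterm_equiv_sym bterm_equiv_trans.

Definition coprod : Type := {eq_quot bterm_equiv}.

HB.instance Definition _ := Choice.on coprod.
HB.instance Definition _ := EqQuotient.on coprod.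

Implicit Types p q r : coprod.

Definition coprod_eval d (D : ctbDistrLatticeType d)
  (f : S -> D) (g : T -> D) p : D := beval f g (repr p).

Lemma coprod_eval_pi d (D : ctbDistrLatticeType d)
    (f : {bmorphism S -> D}) (g : {bmorphism T -> D}) t :
  coprod_eval f g (\pi_coprod t) = beval f g t.
Proof.
have : repr (\pi_coprod t) = t %[mod coprod] by rewrite reprK.
by move/eqmodP/asboolP; apply.
Qed.

Lemma coprod_ext p q :
  (forall d (D : ctbDistrLatticeType d)
     (f : {bmorphism S -> D}) (g : {bmorphism T -> D}),
     coprod_eval f g p = coprod_eval f g q) -> p = q.
Proof.
by move=> pq; rewrite -[p]reprK -[q]reprK; apply/eqmodP/asboolP; apply: pq.
Qed.

Definition coprod_meet p q : coprod := \pi_coprod (BMeet (repr p) (repr q)).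
Definition coprod_join p q : coprod := \pi_coprod (BJoin (repr p) (repr q)).
Definition coprod_compl p : coprod := \pi_coprod (BCompl (repr p)).
Definition coprod_bot : coprod := \pi_coprod BBot.
Definition coprod_top : coprod := \pi_coprod BTop.

Section Eval.
Context d (D : ctbDistrLatticeType d).
Variables (f : {bmorphism S -> D}) (g : {bmorphism T -> D}).

Lemma coprod_evalI p q :
  coprod_eval f g (coprod_meet p q) = coprod_eval f g p `&` coprod_eval f g q.
Proof. by rewrite coprod_eval_pi. Qed.

Lemma coprod_evalU p q :
  coprod_eval f g (coprod_join p q) = coprod_eval f g p `|` coprod_eval f g q.
Proof. by rewrite coprod_eval_pi. Qed.

Lemma coprod_evalC p :
  coprod_eval f g (coprod_compl p) = ~` coprod_eval f g p.
Proof. by rewrite coprod_eval_pi. Qed.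

Lemma coprod_eval0 : coprod_eval f g coprod_bot = \bot.
Proof. by rewrite coprod_eval_pi. Qed.

Lemma coprod_eval1 : coprod_eval f g coprod_top = \top.
Proof. by rewrite coprod_eval_pi. Qed.

End Eval.

Let evalE := (coprod_evalI, coprod_evalU, coprod_evalC, coprod_eval0,
              coprod_eval1).

Fact coprod_meetC : commutative coprod_meet.
Proof. by move=> p q; apply: coprod_ext => *; rewrite !evalE meetC. Qed.
Fact coprod_joinC : commutative coprod_join.
Proof. by move=> p q; apply: coprod_ext => *; rewrite !evalE joinC. Qed.
Fact coprod_meetA : associative coprod_meet.
Proof. by move=> p q r; apply: coprod_ext => *; rewrite !evalE meetA. Qed.
Fact coprod_joinA : associative coprod_join.
Proof. by move=> p q r; apply: coprod_ext => *; rewrite !evalE joinA. Qed.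
Fact coprod_joinKI q p : coprod_meet p (coprod_join p q) = p.
Proof. by apply: coprod_ext => *; rewrite !evalE joinKI. Qed.
Fact coprod_meetKU q p : coprod_join p (coprod_meet p q) = p.
Proof. by apply: coprod_ext => *; rewrite !evalE meetKU. Qed.
Fact coprod_meetUl : left_distributive coprod_meet coprod_join.
Proof. by move=> p q r; apply: coprod_ext => *; rewrite !evalE meetUl. Qed.
Fact coprod_meetxx : idempotent_op coprod_meet.
Proof. by move=> p; apply: coprod_ext => *; rewrite !evalE meetxx. Qed.

HB.instance Definition _ :=
  Order.isMeetJoinDistrLattice.Build (Order.Disp tt tt) coprod
    (fun _ _ => erefl) (fun _ _ => erefl)
    coprod_meetC coprod_joinC coprod_meetA coprod_joinA
    coprod_joinKI coprod_meetKU coprod_meetUl coprod_meetxx.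

Fact coprod_le0 p : coprod_bot <= p.
Proof. by apply/meet_idPl; apply: coprod_ext => *; rewrite !evalE meet0x. Qed.

Fact coprod_le1 p : p <= coprod_top.
Proof. by apply/meet_idPl; apply: coprod_ext => *; rewrite !evalE meetx1. Qed.

HB.instance Definition _ := Order.hasBottom.Build _ coprod coprod_le0.
HB.instance Definition _ := Order.hasTop.Build _ coprod coprod_le1.

Fact coprod_joinxC p : p `|` coprod_compl p = \top.
Proof. by apply: coprod_ext => *; rewrite !evalE joinxC. Qed.

Fact coprod_meetxC p : p `&` coprod_compl p = \bot.
Proof. by apply: coprod_ext => *; rewrite !evalE meetxC. Qed.

HB.instance Definition _ :=
  Order.TBDistrLattice_hasComplement.Build _ coprod
    coprod_joinxC coprod_meetxC.

Lemma coprod_piI t u :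
  \pi_coprod (BMeet t u) = (\pi_coprod t : coprod) `&` (\pi_coprod u : coprod).
Proof. by apply: coprod_ext => *; rewrite evalE !coprod_eval_pi. Qed.

Lemma coprod_piU t u :
  \pi_coprod (BJoin t u) = (\pi_coprod t : coprod) `|` (\pi_coprod u : coprod).
Proof. by apply: coprod_ext => *; rewrite evalE !coprod_eval_pi. Qed.

Lemma coprod_piC t : \pi_coprod (BCompl t) = ~` (\pi_coprod t : coprod).
Proof. by apply: coprod_ext => *; rewrite evalE !coprod_eval_pi. Qed.

Definition coprod_inl_fun (x : S) : coprod := \pi_coprod (BInl x).
Definition coprod_inr_fun (y : T) : coprod := \pi_coprod (BInr y).

Lemma coprod_eval_inl d (D : ctbDistrLatticeType d)
    (f : {bmorphism S -> D}) (g : {bmorphism T -> D}) x :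
  coprod_eval f g (coprod_inl_fun x) = f x.
Proof. by rewrite coprod_eval_pi. Qed.

Lemma coprod_eval_inr d (D : ctbDistrLatticeType d)
    (f : {bmorphism S -> D}) (g : {bmorphism T -> D}) y :
  coprod_eval f g (coprod_inr_fun y) = g y.
Proof. by rewrite coprod_eval_pi. Qed.

Let injE := (coprod_eval_inl, coprod_eval_inr, evalE).

Fact coprod_inlI : {morph coprod_inl_fun : x y / x `&` y}.
Proof. by move=> x y; apply: coprod_ext => *; rewrite !injE omorphI. Qed.
Fact coprod_inlU : {morph coprod_inl_fun : x y / x `|` y}.
Proof. by move=> x y; apply: coprod_ext => *; rewrite !injE omorphU. Qed.
Fact coprod_inlC : {morph coprod_inl_fun : x / ~` x}.
Proof. by move=> x; apply: coprod_ext => *; rewrite !injE bmorphC. Qed.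
Fact coprod_inl0 : coprod_inl_fun \bot = \bot.
Proof. by apply: coprod_ext => *; rewrite !injE omorph0. Qed.
Fact coprod_inl1 : coprod_inl_fun \top = \top.
Proof. by apply: coprod_ext => *; rewrite !injE omorph1. Qed.

HB.instance Definition _ := isBooleanMorphism.Build _ _ _ _ coprod_inl_fun
  coprod_inlI coprod_inlU coprod_inlC coprod_inl0 coprod_inl1.

Fact coprod_inrI : {morph coprod_inr_fun : x y / x `&` y}.
Proof. by move=> x y; apply: coprod_ext => *; rewrite !injE omorphI. Qed.
Fact coprod_inrU : {morph coprod_inr_fun : x y / x `|` y}.
Proof. by move=> x y; apply: coprod_ext => *; rewrite !injE omorphU. Qed.
Fact coprod_inrC : {morph coprod_inr_fun : x / ~` x}.
Proof. by move=> x; apply: coprod_ext => *; rewrite !injE bmorphC. Qed.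
Fact coprod_inr0 : coprod_inr_fun \bot = \bot.
Proof. by apply: coprod_ext => *; rewrite !injE omorph0. Qed.
Fact coprod_inr1 : coprod_inr_fun \top = \top.
Proof. by apply: coprod_ext => *; rewrite !injE omorph1. Qed.

HB.instance Definition _ := isBooleanMorphism.Build _ _ _ _ coprod_inr_fun
  coprod_inrI coprod_inrU coprod_inrC coprod_inr0 coprod_inr1.

Definition coprod_inl : {bmorphism S -> coprod} := coprod_inl_fun.
Definition coprod_inr : {bmorphism T -> coprod} := coprod_inr_fun.

Section Universal.
Context d (D : ctbDistrLatticeType d).
Variables (f : {bmorphism S -> D}) (g : {bmorphism T -> D}).

HB.instance Definition _ :=
  isBooleanMorphism.Build _ _ _ _ (coprod_eval f g)
    (coprod_evalI f g) (coprod_evalU f g) (coprod_evalC f g)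
    (coprod_eval0 f g) (coprod_eval1 f g).

Definition coprod_rec : {bmorphism coprod -> D} := coprod_eval f g.

Lemma coprod_rec_inl x : coprod_rec (coprod_inl x) = f x.
Proof. exact: coprod_eval_inl. Qed.

Lemma coprod_rec_inr y : coprod_rec (coprod_inr y) = g y.
Proof. exact: coprod_eval_inr. Qed.

Lemma coprod_rec_unique (h : {bmorphism coprod -> D}) :
  (forall x, h (coprod_inl x) = f x) -> (forall y, h (coprod_inr y) = g y) ->
  h =1 coprod_rec.
Proof.
move=> hf hg p; rewrite -[p]reprK; elim: (repr p) => {p}.
- by move=> x; rewrite [LHS]hf [RHS]coprod_rec_inl.
- by move=> y; rewrite [LHS]hg [RHS]coprod_rec_inr.
- by rewrite [LHS]omorph0 [RHS]omorph0.
- by rewrite [LHS]omorph1 [RHS]omorph1.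
- by move=> t IHt u IHu; rewrite coprod_piI [LHS]omorphI [RHS]omorphI;
  congr Order.meet.
- by move=> t IHt u IHu; rewrite coprod_piU [LHS]omorphU [RHS]omorphU;
  congr Order.join.
- by move=> t IHt; rewrite coprod_piC [LHS]bmorphC [RHS]bmorphC;
  congr Order.compl.
Qed.

End Universal.
End Coproduct.

Definition canonical_morphism d (C : ctbDistrLatticeType d)
    (A B : subalgebra C) : {bmorphism coprod A B -> subalgebra_join A B} :=
  coprod_rec (joinl A B) (joinr A B).

(* Main.v *)
From HB Require Import structures.
Require Import Defs.
From mathcomp Require Import all_boot all_order.
From mathcomp Require Import boolp classical_sets.

(** Everything rests on the Boolean prime ideal theorem
    ([bool_morphism_extends]): a meet-closed family avoiding the bottom is sent
    to true by some two-valued homomorphism.  Hence two-valued homomorphisms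
    detect nonzero elements and separate points.

    If A and B are subalgebra-independent and a in A, b in B are nonzero, take
    two-valued homomorphisms sending a and b to true and regard them as
    endomorphisms of A and of B.  Their common extension sends the meet of a
    and b to the top, so this meet is not the bottom
    ([subalgebra_independent_boole]).

    The canonical morphism q is always surjective, because its image is a
    subalgebra containing A and B ([canonical_morphism_surj]).  If A and B are
    Boole-independent, q is also injective ([canonical_morphism_inj]): a
    two-valued homomorphism h on the coproduct amounts to a pair of ultrafilters
    on A and B; independence says that together they generate a proper filter
    of the join, so they have a common extension u
    ([boole_independent_extension]); then h is the composite of u and q, and so
    whatever h separates is separated by q.

    Finally, if q is an isomorphism, the join inherits the universal property of
    the coproduct, which extends endomorphisms of A and B to the join
    ([boolean_iso_independent]). *)

Set Implicit Arguments.
Unset Strict Implicit.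
Unset Printing Implicit Defensive.

Import Order.Theory.

Local Open Scope order_scope.

Section PrimeIdeal.
Context d (T : ctbDistrLatticeType d).
Implicit Types x y z : T.

Lemma ultrafilter_bool_morphism (U : set T) :
  U \top -> (forall x y, U (x `&` y) <-> U x /\ U y) ->
  (forall x, U (~` x) <-> ~ U x) ->
  exists h : {bmorphism T -> bool}, forall x, h x <-> U x.
Proof.
move=> U1 UI UC.
pose h x : bool := `[< U x >].
have hI : {morph h : x y / x `&` y}.
  by move=> x y; rewrite /h (propext (UI x y)) asbool_and.
have hC : {morph h : x / ~` x}.
  by move=> x; rewrite /h (propext (UC x)) asbool_neg.
have hU : {morph h : x y / x `|` y}.
  move=> x y; rewrite -[x `|` y]complK complU hC hI !hC.
  by case: (h x); case: (h y).
have h1 : h \top = \top by apply/asboolP.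
have h0 : h \bot = \bot by rewrite -compl1 hC h1.
pose hM := isBooleanMorphism.Build _ _ _ _ h hI hU hC h0 h1.
pose hB : {bmorphism T -> bool} := HB.pack h hM.
by exists hB => x; split=> /asboolP.
Qed.

(** Zorn's lemma extends the filter base to a maximal one, which is an
    ultrafilter. *)
Lemma bool_morphism_extends (F : set T) :
  F \top -> (forall x y, F x -> F y -> F (x `&` y)) -> ~ F \bot ->
  exists h : {bmorphism T -> bool}, forall x, F x -> h x.
Proof.
move=> F1 FI F0.
(* The empty set is admitted because the union of the empty chain has to
   qualify; it is never maximal. *)
pose P (U : set T) := [/\ forall x y, U x -> U y -> U (x `&` y),
  ~ U \bot & U = set0 \/ (F `<=` U)%classic].
have [|U [[UI U0 UF] maxU]] := @Zorn_bigcup T P.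
  move=> K KP Ktot; split.
  - move=> x y [X KX Xx] [Y KY Yy]; case: (Ktot X Y KX KY) => XY.
    + by exists Y => //; have [YI _ _] := KP _ KY; apply: YI => //; apply: XY.
    + by exists X => //; have [XI _ _] := KP _ KX; apply: XI => //; apply: XY.
  - by move=> [X KX X0]; have [_ ? _] := KP _ KX.
  - have [[X [KX FX]]|noF] := pselect (exists X, K X /\ (F `<=` X)%classic).
      by right=> x Fx; exists X => //; apply: FX.
    left; apply/seteqP; split=> // x [X KX Xx].
    have [_ _ [X0|FX]] := KP _ KX; first by rewrite X0 in Xx.
    by case: noF; exists X.
have {}UF : (F `<=` U)%classic.
  case: UF => // UE; exfalso; apply: (maxU F); last by split=> //; right.
  by rewrite UE; split=> // /(_ _ F1).
(* By maximality, whatever is compatible with the base belongs to it. *)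
have Umax x : (forall y, U y -> y `&` x <> \bot) -> U x.
  move=> Ux; apply: contrapT => nUx.
  pose V z := U z \/ exists2 y, U y & z = y `&` x.
  apply: (maxU V).
    split=> [z Uz|/(_ x) VU]; first by left.
    by apply/nUx/VU; right; exists \top; [exact: UF | rewrite meet1x].
  split.
  - move=> z t [Uz|[y Uy ->]] [Ut|[y' Uy' ->]].
    + by left; apply: UI.
    + by right; exists (z `&` y'); [apply: UI | rewrite meetA].
    + by right; exists (y `&` t); [apply: UI | rewrite meetAC].
    + by right; exists (y `&` y'); [apply: UI | rewrite meetACA meetxx].
  - by case=> // -[y Uy /esym]; apply: Ux.
  - by right=> z Fz; left; apply: UF.
have Uup x y : x <= y -> U x -> U y.
  move=> xy Ux; apply: Umax => z Uz zy0; apply: U0.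
  suff <- : z `&` x = \bot by apply: UI.
  by apply/eqP; rewrite -lex0 -zy0 leI2.
have [|x y|x|h hU] := @ultrafilter_bool_morphism U.
- exact: UF.
- split=> [Uxy|[]]; last exact: UI.
  by split; apply: Uup Uxy; rewrite (leIl, leIr).
- split=> [UCx Ux|nUx].
    by apply: U0; rewrite -(meetxC x); apply: UI.
  apply: Umax => y Uy /eqP; rewrite disj_leC complK => yx.
  exact/nUx/(Uup y).
- by exists h => x /UF /hU.
Qed.

Lemma bool_morphism_neq0 x :
  x <> \bot -> exists h : {bmorphism T -> bool}, h x.
Proof.
move=> x0; have [||/=|h hP] := @bool_morphism_extends (fun y => x <= y).
- exact: lex1.
- by move=> y z /= xy xz; rewrite lexI; apply/andP.
- by rewrite lex0 => /eqP.
- by exists h; apply: hP => /=.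
Qed.

Lemma bool_morphism_ext x y :
  (forall h : {bmorphism T -> bool}, h x = h y) -> x = y.
Proof.
have sub z t : (forall h : {bmorphism T -> bool}, h z = h t) -> z <= t.
  move=> hzt; rewrite -[t]complK -disj_leC; apply: contrapT => zt0.
  have [|h] := @bool_morphism_neq0 (z `&` ~` t); first by move/eqP.
  rewrite omorphI /= bmorphC hzt.
  by case: (h t).
by move=> hxy; apply: le_anti; rewrite !sub.
Qed.

End PrimeIdeal.

Section BoolEmbedding.
Context d (T : ctbDistrLatticeType d).

Definition bool_embed_fun (b : bool) : T := if b then \top else \bot.

Fact bool_embedI : {morph bool_embed_fun : x y / x `&` y}.
Proof. by case=> -[]; rewrite /= ?meet1x ?meet0x. Qed.
Fact bool_embedU : {morph bool_embed_fun : x y / x `|` y}.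
Proof. by case=> -[]; rewrite /= ?join1x ?join0x. Qed.
Fact bool_embedC : {morph bool_embed_fun : x / ~` x}.
Proof. by case; rewrite /= ?compl1 ?compl0. Qed.

HB.instance Definition _ := isBooleanMorphism.Build _ _ _ _ bool_embed_fun
  bool_embedI bool_embedU bool_embedC erefl erefl.

Definition bool_embed : {bmorphism bool -> T} := bool_embed_fun.

End BoolEmbedding.

Lemma bijective_boolean_iso d (S : ctbDistrLatticeType d)
    d' (T : ctbDistrLatticeType d') (f : {bmorphism S -> T}) :
  injective f -> (forall y, exists x, f x = y) -> boolean_iso f.
Proof.
move=> finj /choice[g gK]; have fK : cancel f g by move=> x; apply: finj.
have gI : {morph g : x y / x `&` y}.
  by move=> x y; apply: finj; rewrite omorphI /= !gK.
have gU : {morph g : x y / x `|` y}.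
  by move=> x y; apply: finj; rewrite omorphU /= !gK.
have gC : {morph g : x / ~` x}.
  by move=> x; apply: finj; rewrite bmorphC !gK.
have g0 : g \bot = \bot by apply: finj; rewrite omorph0 gK.
have g1 : g \top = \top by apply: finj; rewrite omorph1 gK.
pose gM := isBooleanMorphism.Build _ _ _ _ g gI gU gC g0 g1.
pose gB : {bmorphism T -> S} := HB.pack g gM.
by exists gB.
Qed.

Section Independence.
Context d (C : ctbDistrLatticeType d) (A B : subalgebra C).

Lemma subalgebra_independent_boole :
  subalgebra_independent A B -> boole_independent A B.
Proof.
move=> indep a b Aa Bb a0 b0 ab0.
pose a' : A := exist _ a (mem_set Aa); pose b' : B := exist _ b (mem_set Bb).
have [|f fa] := @bool_morphism_neq0 _ A a'; first by move/(congr1 val).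
have [|g gb] := @bool_morphism_neq0 _ B b'; first by move/(congr1 val).
(* The bottom and top of A and B make endomorphisms of f and g. *)
pose alpha : {bmorphism A -> A} := bool_embed A \o f.
pose beta : {bmorphism B -> B} := bool_embed B \o g.
have [gamma [gammaA gammaB]] := indep alpha beta.
have alphaa : alpha a' = \top by rewrite /alpha /= fa.
have betab : beta b' = \top by rewrite /beta /= gb.
have : joinl A B a' `&` joinr A B b' = \bot by apply: val_inj.
move=> /(congr1 gamma); rewrite omorphI /= gammaA gammaB alphaa betab.
rewrite !omorph1 omorph0 meetxx => /(congr1 val) /= C01.
by apply: a0; apply/eqP; rewrite -lex0 -[\bot]C01 lex1.
Qed.

(** Independence makes the meets of an element of one ultrafilter with one of
    the other nonzero, so that they form a proper filter base. *)
Lemma boole_independent_extension (f : {bmorphism A -> bool})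
    (g : {bmorphism B -> bool}) : boole_independent A B ->
  exists u : {bmorphism subalgebra_join A B -> bool},
    (forall a, u (joinl A B a) = f a) /\ (forall b, u (joinr A B b) = g b).
Proof.
move=> indep.
pose F x := exists a b, [/\ f a, g b & x = joinl A B a `&` joinr A B b].
have [||/=|u uF] := @bool_morphism_extends _ (subalgebra_join A B) F.
- by exists \top, \top; rewrite !omorph1 meetxx.
- move=> _ _ [a [b [fa gb ->]]] [a' [b' [fa' gb' ->]]].
  exists (a `&` a'), (b `&` b').
  by rewrite !omorphI /= fa fa' gb gb' meetACA.
- move=> [a [b [fa gb /(congr1 val) /esym]]].
  apply: (indep _ _ (set_mem (valP a)) (set_mem (valP b))).
  + by move=> a0; move: fa; rewrite (_ : a = \bot) ?omorph0 //; apply: val_inj.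
  + by move=> b0; move: gb; rewrite (_ : b = \bot) ?omorph0 //; apply: val_inj.
have uA a : f a -> u (joinl A B a).
  by move=> fa; apply: uF; exists a, \top; rewrite fa !omorph1 meetx1.
have uB b : g b -> u (joinr A B b).
  by move=> gb; apply: uF; exists \top, b; rewrite gb !omorph1 meet1x.
exists u; split=> [a|b]; apply/idP/idP; [|exact: uA| |exact: uB].
- by apply: contraLR => nfa; have := uA (~` a); rewrite !bmorphC; apply.
- by apply: contraLR => ngb; have := uB (~` b); rewrite !bmorphC; apply.
Qed.

(** Two-valued homomorphisms separate the points of the coproduct, and by
    independence each of them factors through the canonical morphism. *)
Lemma canonical_morphism_inj :
  boole_independent A B -> injective (canonical_morphism A B).
Proof.
move=> indep p p' qpp'; apply: bool_morphism_ext => h.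
pose f : {bmorphism A -> bool} := h \o coprod_inl A B.
pose g : {bmorphism B -> bool} := h \o coprod_inr A B.
have [u [uA uB]] := boole_independent_extension f g indep.
pose uq : {bmorphism coprod A B -> bool} := u \o canonical_morphism A B.
have uqE : uq =1 h.
  move=> r; rewrite (@coprod_rec_unique _ _ _ _ _ _ f g uq).
  - by rewrite (@coprod_rec_unique _ _ _ _ _ _ f g h).
  - by move=> a; rewrite -uA /uq /= -[in RHS](coprod_rec_inl _ (joinr A B)).
  - by move=> b; rewrite -uB /uq /= -[in RHS](coprod_rec_inr (joinl A B)).
by rewrite -!uqE /uq /= qpp'.
Qed.

Lemma canonical_morphism_surj (y : subalgebra_join A B) :
  exists p, canonical_morphism A B p = y.
Proof.
pose q := canonical_morphism A B.
suff [p qp] : exists p, val (q p) = val y by exists p; apply: val_inj.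
apply: (set_mem (valP y) [set c | exists p, val (q p) = c]%classic); split.
  split.
  - by exists \bot; rewrite omorph0.
  - by exists \top; rewrite omorph1.
  - by move=> _ _ [p <-] [p' <-]; exists (p `&` p'); rewrite omorphI.
  - by move=> _ _ [p <-] [p' <-]; exists (p `|` p'); rewrite omorphU.
  - by move=> _ [p <-]; exists (~` p); rewrite bmorphC.
move=> c [Ac|Bc].
- exists (coprod_inl A B (exist _ c (mem_set Ac))).
  by rewrite /q /canonical_morphism coprod_rec_inl.
- exists (coprod_inr A B (exist _ c (mem_set Bc))).
  by rewrite /q /canonical_morphism coprod_rec_inr.
Qed.

Lemma boolean_iso_independent :
  boolean_iso (canonical_morphism A B) -> subalgebra_independent A B.
Proof.
move=> [r [qK _]] alpha beta.
pose f : {bmorphism A -> subalgebra_join A B} := joinl A B \o alpha.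
pose g : {bmorphism B -> subalgebra_join A B} := joinr A B \o beta.
(* The map from the coproduct induced by alpha and beta, transported along the
   inverse r of the canonical morphism. *)
pose gamma : {bmorphism subalgebra_join A B -> subalgebra_join A B} :=
  coprod_rec f g \o r.
exists gamma; split=> [a|b].
- rewrite -[in LHS](coprod_rec_inl (joinl A B) (joinr A B)).
  by rewrite [LHS](congr1 (coprod_rec f g) (qK _)) coprod_rec_inl.
- rewrite -[in LHS](coprod_rec_inr (joinl A B) (joinr A B)).
  by rewrite [LHS](congr1 (coprod_rec f g) (qK _)) coprod_rec_inr.
Qed.

End Independence.

Theorem proposition2p9 (d : Order.disp_t) (C : ctbDistrLatticeType d)
    (A B : subalgebra C) :
  (subalgebra_independent A B <-> boole_independent A B) /\
  (boole_independent A B <-> boolean_iso (canonical_morphism A B)).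
Proof.
have iso : boole_independent A B -> boolean_iso (canonical_morphism A B).
  move=> indep; apply: bijective_boolean_iso.
  - exact: canonical_morphism_inj.
  - exact: canonical_morphism_surj.
have sub_boole := @subalgebra_independent_boole d C A B.
have iso_sub := @boolean_iso_independent d C A B.
by split; split=> //; [move=> /iso | move=> /iso_sub].
Qed.
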